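(* Let $r\geq3$ and $q\ge 1$ be integers, $\tau\in\mathbb{C}^*$, and let $X\subset\mathbb{C}^3$ be the surface defined by $$F(X_1,X_2,X_3)=X_1^{(r-2)q}+X_2^q+X_3^r+\tau X_1X_2X_3.$$ Let $\omega\in\mathbb{C}$ with $\omega^{r-1}=1/\tau$, and let $(a,b,c)\in\mathbb{C}^3$ be a point different from the origin such that $$a^{q(r-2)}+b^q=0\quad\text{and}\quad c(c^{r-1}+ab)=0.$$ Let $W_{a,b,c}\subset X$ be the curve parametrized by $\lambda\mapsto(a\lambda\omega,\,b\lambda^{r-2}\omega^{r-2},\,c\lambda)$, and let $M_{a,b,c}$ be the maximal Cohen–Macaulay $\mathcal{O}_X$-module associated to the degeneracy locus $W_{a,b,c}$. Then the matrix factorization associated to $M_{a,b,c}$ is given by the matrix $$A=\begin{pmatrix}G_{(c,a\omega,1)}(X_1,X_3)&-G_{(b,a,r-2)}(X_1,X_2)\\ S_{(b,a,r-2,q)}(X_1,X_2)+\frac{cX_1^2}{a\omega^r}S_{(b,a,r-2,1)}(X_1,X_2)&S_{(c,a\omega,1,r)}(X_1,X_3)+\frac{X_1X_2}{\omega^{r-1}}S_{(c,a\omega,1,1)}(X_1,X_3)\end{pmatrix},$$ i.e. by the pair $(\mathrm{adj}(A),A)$ (a matrix factorization of the defining equation $-F$ of $X$), where $G_{(c_1,c_2,n)}(Z_1,Z_2):=c_1Z_1^n-c_2^nZ_2$ and $$S_{(c_1,c_2,n,m)}(Z_1,Z_2):=\sum_{j=1}^m\frac{Z_1^{(j-1)n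}Z_2^{m-j}c_1^{j-1}}{c_2^{jn}}.$$
   Context: $\mathcal{O}_{\mathbb{C}^3}:=\mathbb{C}[[X_1,X_2,X_3]]$, $\mathcal{O}_X:=\mathcal{O}_{\mathbb{C}^3}/(F)$. The maximal Cohen–Macaulay module associated to the degeneracy locus $W$ (a non-singular curve in $X$, taken with its point at the origin) is the rank one module $M$ with a section $s$ such that the cokernel $\mathcal{C}_s$ of $\mathcal{O}_X\xrightarrow{\cdot s}M$ is supported on $W$ and, dualizing, $0\to M^\vee\to\mathcal{O}_X\to\mathcal{O}_W\to0$ is exact; i.e. $M=\mathrm{Hom}_{\mathcal{O}_X}(I_W,\mathcal{O}_X)$, where $I_W\subset\mathcal{O}_X$ is the ideal of $W$. A matrix factorization of $G\in\mathcal{O}_{\mathbb{C}^3}$ is an ordered pair $(\Psi,\Phi)$ of $m\times m$ matrices over $\mathcal{O}_{\mathbb{C}^3}$ with $\Phi\Psi=\Psi\Phi=G\cdot\mathrm{Id}_m$. The matrix factorization associated to $M$ is the pair $(\Psi,\Phi)$ for which $0\to\mathcal{O}_{\mathbb{C}^3}^{\oplus m}\xrightarrow{\Phi}\mathcal{O}_{\mathbb{C}^3}^{\oplus m}\to M\to0$ is exact (matrices acting on column vectors), with $G$ a defining equation of $X$. $\mathrm{adj}(A)$ is the adjoint (adjugate) matrix. *)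

(* Defs.v *)
From HB Require Import structures.
From mathcomp Require Import all_boot all_order all_algebra.
From mathcomp.multinomials Require Import mpoly.
From mathcomp Require Import boolp reals complex.
From mathcomp Require Import ring.

Set Implicit Arguments.
Unset Strict Implicit.
Unset Printing Implicit Defensive.

Import GRing.Theory.
Local Open Scope ring_scope.

(* [K[[X_0, ..., X_(n-1)]]]: a series is its family of coefficients. *)
Record mpseries (K : Type) (n : nat) :=
  MPSeries { mpcoef :> 'X_{1..n} -> K }.

HB.instance Definition _ (K : Type) n := gen_eqMixin (mpseries K n).
HB.instance Definition _ (K : Type) n := gen_choiceMixin (mpseries K n).

Section PowerSeries.
Variables (K : comNzRingType) (n : nat).
Implicit Types (f g h : mpseries K n) (m : 'X_{1..n}).

Lemma mpseriesP f g : (forall m, f m = g m) -> f = g.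
Proof. by case: f g => [f] [g] /= /funext ->. Qed.

Definition mps_zero : mpseries K n := MPSeries (fun _ => 0).
Definition mps_opp f : mpseries K n := MPSeries (fun m => - f m).
Definition mps_add f g : mpseries K n := MPSeries (fun m => f m + g m).
Definition mps_scale (c : K) f : mpseries K n := MPSeries (fun m => c * f m).
Definition mps_one : mpseries K n := MPSeries (fun m => (m == 0%MM)%:R).
Definition mps_mul f g : mpseries K n := MPSeries (fun m =>
  \sum_(k : 'X_{1..n < (mdeg m).+1, (mdeg m).+1} | m == (k.1 + k.2)%MM)
    f k.1 * g k.2).

Fact mps_addA : associative mps_add.
Proof. by move=> f g h; apply: mpseriesP => m /=; rewrite addrA. Qed.
Fact mps_addC : commutative mps_add.
Proof. by move=> f g; apply: mpseriesP => m /=; rewrite addrC. Qed.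
Fact mps_add0 : left_id mps_zero mps_add.
Proof. by move=> f; apply: mpseriesP => m /=; rewrite add0r. Qed.
Fact mps_addN : left_inverse mps_zero mps_opp mps_add.
Proof. by move=> f; apply: mpseriesP => m /=; rewrite addNr. Qed.

HB.instance Definition _ := GRing.isZmodule.Build (mpseries K n)
  mps_addA mps_addC mps_add0 mps_addN.

Lemma mps_coef0 m : (0 : mpseries K n) m = 0. Proof. by []. Qed.
Lemma mps_coefD f g m : (f + g) m = f m + g m. Proof. by []. Qed.
Lemma mps_coefN f m : (- f) m = - f m. Proof. by []. Qed.
Lemma mps_coefB f g m : (f - g) m = f m - g m. Proof. by []. Qed.
Lemma mps_coef_sum I (r : seq I) P (F : I -> mpseries K n) m :
  (\sum_(i <- r | P i) F i) m = \sum_(i <- r | P i) F i m.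
Proof. by elim/big_rec2: _ => //= i x y _ <-. Qed.

Definition mps_trunc d f : {mpoly K[n]} :=
  \sum_(k : 'X_{1..n < d}) f k *: 'X_[k].

Lemma coef_mps_trunc d f m : (mps_trunc d f)@_m = if (mdeg m < d)%N then f m else 0.
Proof.
case: ltnP => [/mcoeff_mpoly->//|le_dm]; rewrite raddf_sum big1 //= => k _.
rewrite mcoeffZ mcoeffX (_ : _ == _ = false) ?mulr0 //; apply/eqP => kE.
by move: (bmdeg k); rewrite kE ltnNge le_dm.
Qed.

Lemma eq_mcoeffM (p p' q q' : {mpoly K[n]}) m :
  (forall k, (mdeg k <= mdeg m)%N -> p@_k = p'@_k) ->
  (forall k, (mdeg k <= mdeg m)%N -> q@_k = q'@_k) ->
  (p * q)@_m = (p' * q')@_m.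
Proof.
move=> hp hq; rewrite !mcoeffM; apply: eq_bigr => k _.
by rewrite hp ?hq // -ltnS bmdeg.
Qed.

Lemma mps_mulE d f g m : (mdeg m < d)%N ->
  mps_mul f g m = (mps_trunc d f * mps_trunc d g)@_m.
Proof.
move=> lt_md; rewrite mcoeffM; apply: eq_bigr => k _; rewrite !coef_mps_trunc.
by rewrite !(leq_ltn_trans _ lt_md) // -ltnS bmdeg.
Qed.

Lemma mps_trunc_mul d f g m : (mdeg m < d)%N ->
  (mps_trunc d (mps_mul f g))@_m = (mps_trunc d f * mps_trunc d g)@_m.
Proof. by move=> lt_md; rewrite coef_mps_trunc lt_md (mps_mulE _ _ lt_md). Qed.

Lemma mps_trunc_one d m : (mdeg m < d)%N -> (mps_trunc d mps_one)@_m = 1@_m.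
Proof. by move=> lt_md; rewrite coef_mps_trunc lt_md mcoeff1. Qed.

Fact mps_mulA : associative mps_mul.
Proof.
move=> f g h; apply: mpseriesP => m; rewrite !(@mps_mulE (mdeg m).+1) //.
transitivity (mps_trunc (mdeg m).+1 f * (mps_trunc (mdeg m).+1 g
               * mps_trunc (mdeg m).+1 h))@_m.
  by apply: eq_mcoeffM => // k le_km; rewrite mps_trunc_mul.
by rewrite mulrA; apply: eq_mcoeffM => // k le_km; rewrite mps_trunc_mul.
Qed.

Fact mps_mulC : commutative mps_mul.
Proof.
by move=> f g; apply: mpseriesP => m; rewrite !(@mps_mulE (mdeg m).+1) // mulrC.
Qed.

Fact mps_mul1 : left_id mps_one mps_mul.
Proof.
move=> f; apply: mpseriesP => m; rewrite (@mps_mulE (mdeg m).+1) //.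
transitivity ((1 * mps_trunc (mdeg m).+1 f)@_m).
  by apply: eq_mcoeffM => // k le_km; rewrite mps_trunc_one.
by rewrite mul1r coef_mps_trunc leqnn.
Qed.

Fact mps_mulDl : left_distributive mps_mul mps_add.
Proof.
move=> f g h; apply: mpseriesP => m /=; rewrite -big_split /=.
by apply: eq_bigr => k _; rewrite mulrDl.
Qed.

Fact mps_one_neq0 : mps_one != 0.
Proof.
by apply/eqP => /(congr1 (fun f : mpseries K n => f 0%MM)) /eqP;
  rewrite /= eqxx oner_eq0.
Qed.

HB.instance Definition _ := GRing.Zmodule_isComNzRing.Build (mpseries K n)
  mps_mulA mps_mulC mps_mul1 mps_mulDl mps_one_neq0.

Lemma mps_coefM f g m : (f * g) m =
  \sum_(k : 'X_{1..n < (mdeg m).+1, (mdeg m).+1} | m == (k.1 + k.2)%MM)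
    f k.1 * g k.2.
Proof. by []. Qed.

Lemma mps_coef1 m : (1 : mpseries K n) m = (m == 0%MM)%:R.
Proof. by []. Qed.

Fact mps_scaleA a b f : mps_scale a (mps_scale b f) = mps_scale (a * b) f.
Proof. by apply: mpseriesP => m /=; rewrite mulrA. Qed.
Fact mps_scale1 : left_id 1 mps_scale.
Proof. by move=> f; apply: mpseriesP => m /=; rewrite mul1r. Qed.
Fact mps_scaleDr : right_distributive mps_scale +%R.
Proof. by move=> a f g; apply: mpseriesP => m /=; rewrite mulrDr. Qed.
Fact mps_scaleDl f : {morph mps_scale^~ f : a b / a + b}.
Proof. by move=> a b; apply: mpseriesP => m /=; rewrite mulrDl. Qed.

HB.instance Definition _ := GRing.Zmodule_isLmodule.Build K (mpseries K n)
  mps_scaleA mps_scale1 mps_scaleDr mps_scaleDl.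

Lemma mps_coefZ c f m : (c *: f) m = c * f m. Proof. by []. Qed.

Fact mps_scaleAl c f g : c *: (f * g) = (c *: f) * g.
Proof.
apply: mpseriesP => m; rewrite mps_coefZ !mps_coefM mulr_sumr.
by apply: eq_bigr => k _; rewrite mulrA.
Qed.

HB.instance Definition _ :=
  GRing.Lmodule_isLalgebra.Build K (mpseries K n) mps_scaleAl.
HB.instance Definition _ := GRing.Lalgebra_isComAlgebra.Build K (mpseries K n).

Definition mpvar (i : 'I_n) : mpseries K n :=
  MPSeries (fun m => (m == U_(i)%MM)%:R).

End PowerSeries.

Arguments mpcoef : simpl never.

(* The vanishing of the constant terms is what makes the substitution
   [f(x_1, ..., x_n)] meaningful; for [p = 1] this is a parametrized formal
   curve through the origin. *)
Record germ_map (K : comNzRingType) (n p : nat) := GermMap {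
  germ_coord :> 'I_n -> mpseries K p;
  germ_coord0 : forall i, germ_coord i 0%MM = 0
}.

Section Substitution.
Variables (K : comNzRingType) (n p : nat) (x : germ_map K n p).
Implicit Types (f g : mpseries K n).

(* Multi-exponents [k] with [mdeg k > mdeg m] contribute nothing to the
   coefficient at [m], so that the sum may be restricted to a finite range. *)
Definition mps_subst f : mpseries K p := MPSeries (fun m =>
  \sum_(k : 'X_{1..n < (mdeg m).+1}) f k * (\prod_(i < n) x i ^+ k i) m).

Lemma mps_low_mul (f g : mpseries K p) d e :
  (forall m, (mdeg m < d)%N -> f m = 0) -> (forall m, (mdeg m < e)%N -> g m = 0) ->
  forall m, (mdeg m < d + e)%N -> (f * g) m = 0.
Proof.
move=> hf hg m lt_m; rewrite mps_coefM big1 // => k /eqP/(congr1 mdeg); rewrite mdegD => mE.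
have [lt1|ge1] := ltnP (mdeg k.1) d; first by rewrite hf ?mul0r.
rewrite (hg k.2) ?mulr0 //; move: lt_m; rewrite [in X in X -> _]mE ltnNge.
by apply: contraNltn => ge2; rewrite leq_add.
Qed.

Lemma mps_low_exp (f : mpseries K p) d : f 0%MM = 0 ->
  forall m, (mdeg m < d)%N -> (f ^+ d) m = 0.
Proof.
move=> f0; elim: d => [//|d IHd] m; rewrite exprS.
by apply: (@mps_low_mul _ _ 1) => // k; rewrite ltnS leqn0 mdeg_eq0 => /eqP->.
Qed.

Lemma mps_low_monom (k : 'X_{1..n}) m : (mdeg m < mdeg k)%N ->
  (\prod_(i < n) x i ^+ k i) m = 0.
Proof.
rewrite [mdeg k]mdegE; move: m.
pose P d (f : mpseries K p) := forall m, (mdeg m < d)%N -> f m = 0.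
rewrite -[forall m, _]/(P (\sum_i k i)%N (\prod_(i < n) x i ^+ k i)).
refine (big_rec2 P _ _) => // i d f _ IH m; apply: mps_low_mul => // m'.
by apply: mps_low_exp; apply: germ_coord0.
Qed.

Local Notation ev := (mmap (GRing.in_alg (mpseries K p)) x).

Lemma mps_low_mmap (q : {mpoly K[n]}) m :
  (forall k, (mdeg k <= mdeg m)%N -> q@_k = 0) -> ev q m = 0.
Proof.
move=> hq; rewrite /mmap mps_coef_sum big1 // => k _ /=.
have [le_km|lt_mk] := leqP (mdeg k) (mdeg m).
  by rewrite hq // scale0r mul0r.
by rewrite /= -scalerAl mul1r mps_coefZ /mmap1 mps_low_monom ?mulr0.
Qed.

Lemma eq_mps_mmap (q q' : {mpoly K[n]}) m :
  (forall k, (mdeg k <= mdeg m)%N -> q@_k = q'@_k) -> ev q m = ev q' m.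
Proof.
move=> hq; apply/eqP; rewrite -subr_eq0 -mps_coefB -rmorphB.
by rewrite mps_low_mmap // => k le_km; rewrite mcoeffB hq // subrr.
Qed.

Lemma mps_substE d f m : (mdeg m < d)%N -> mps_subst f m = ev (mps_trunc d f) m.
Proof.
move=> lt_md; transitivity (ev (mps_trunc (mdeg m).+1 f) m).
  rewrite rmorph_sum /= mps_coef_sum; apply: eq_bigr => k _.
  by rewrite mmapZ mmapX /= -scalerAl mul1r mps_coefZ.
apply: eq_mps_mmap => k le_km; rewrite !coef_mps_trunc ltnS le_km.
by rewrite (leq_ltn_trans le_km).
Qed.

Fact mps_subst_is_zmod_morphism : zmod_morphism mps_subst.
Proof.
move=> f g; apply: mpseriesP => m; rewrite mps_coefB /= -sumrB.
by apply: eq_bigr => k _; rewrite mps_coefB mulrBl.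
Qed.

Fact mps_subst_is_monoid_morphism : monoid_morphism mps_subst.
Proof.
split=> [|f g]; apply: mpseriesP => m.
  rewrite (@mps_substE (mdeg m).+1) // -(rmorph1 ev); apply: eq_mps_mmap => k le_km.
  by rewrite mps_trunc_one.
rewrite (@mps_substE (mdeg m).+1) //.
transitivity (ev (mps_trunc (mdeg m).+1 f * mps_trunc (mdeg m).+1 g) m).
  by apply: eq_mps_mmap => k le_km; rewrite mps_trunc_mul.
rewrite rmorphM !mps_coefM; apply: eq_bigr => k _.
by rewrite !(@mps_substE (mdeg m).+1) ?bmdeg.
Qed.

HB.instance Definition _ := GRing.isZmodMorphism.Build
  (mpseries K n) (mpseries K p) mps_subst mps_subst_is_zmod_morphism.
HB.instance Definition _ := GRing.isMonoidMorphism.Build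
  (mpseries K n) (mpseries K p) mps_subst mps_subst_is_monoid_morphism.

End Substitution.

Section PrincipalIdeal.
Variables (O : comNzRingType) (F : O).

Definition principal_ideal : {pred O} := fun f => `[< exists h, f = h * F >].

Lemma principal_idealP f : reflect (exists h, f = h * F) (f \in principal_ideal).
Proof. exact: asboolP. Qed.

Fact principal_ideal_zmod_closed : zmod_closed principal_ideal.
Proof.
split=> [|_ _ /principal_idealP[g ->] /principal_idealP[h ->]].
  by apply/principal_idealP; exists 0; rewrite mul0r.
by apply/principal_idealP; exists (g - h); rewrite mulrBl.
Qed.

HB.instance Definition _ :=
  GRing.isZmodClosed.Build O principal_ideal principal_ideal_zmod_closed.

End PrincipalIdeal.

Section CoordRing.
Local Open Scope quotient_scope.
Variables (O : comNzRingType) (F : O).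

(* [{ideal_quot _}] carries a ring structure for proper ideals only; here the
   quotient is allowed to be trivial. *)
Definition coord_ring := Quotient.quot (principal_ideal F).

HB.instance Definition _ := GRing.Zmodule.on coord_ring.

Definition coord_proj (f : O) : coord_ring := \pi_coord_ring f.

Lemma coord_projE f g : coord_proj f = coord_proj g <-> f - g \in principal_ideal F.
Proof.
rewrite Quotient.idealrBE /coord_proj; split=> [eq_fg|]; last by move/eqP.
by apply/eqP.
Qed.

Lemma coord_proj_surj (x : coord_ring) : exists f, x = coord_proj f.
Proof. by exists (repr x); rewrite /coord_proj reprK. Qed.

Definition coord_one : coord_ring := coord_proj 1.
Definition coord_mul (x y : coord_ring) : coord_ring :=
  coord_proj (repr x * repr y).

Lemma coord_projM f g : coord_proj (f * g) = coord_mul (coord_proj f) (coord_proj g).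
Proof.
have reprE h : exists e, repr (coord_proj h) = h + e * F.
  have /coord_projE/principal_idealP[e eE] :
      coord_proj (repr (coord_proj h)) = coord_proj h by rewrite /coord_proj reprK.
  by exists e; rewrite -eE addrC subrK.
have [[d dE] [e eE]] := (reprE f, reprE g).
apply/coord_projE/principal_idealP; rewrite dE eE.
exists (- (f * e + d * (g + e * F))).
by ring.
Qed.

Fact coord_mulA : associative coord_mul.
Proof.
move=> x y z; have [[[f ->] [g ->]] [h ->]] :=
  (coord_proj_surj x, coord_proj_surj y, coord_proj_surj z).
by rewrite -!coord_projM mulrA.
Qed.

Fact coord_mulC : commutative coord_mul.
Proof.
move=> x y; have [[f ->] [g ->]] := (coord_proj_surj x, coord_proj_surj y).
by rewrite -!coord_projM mulrC.
Qed.

Fact coord_mul1 : left_id coord_one coord_mul.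
Proof.
by move=> x; have [f ->] := coord_proj_surj x; rewrite -coord_projM mul1r.
Qed.

Fact coord_proj_is_zmod_morphism : zmod_morphism coord_proj.
Proof. exact: pi_is_zmod_morphism. Qed.

HB.instance Definition _ := GRing.isZmodMorphism.Build O coord_ring coord_proj
  coord_proj_is_zmod_morphism.

Fact coord_mulDl : left_distributive coord_mul +%R.
Proof.
move=> x y z; have [[[f ->] [g ->]] [h ->]] :=
  (coord_proj_surj x, coord_proj_surj y, coord_proj_surj z).
by rewrite -raddfD -!coord_projM mulrDl raddfD.
Qed.

HB.instance Definition _ := GRing.Zmodule_isComPzRing.Build coord_ring
  coord_mulA coord_mulC coord_mul1 coord_mulDl.

Fact coord_proj_is_monoid_morphism : monoid_morphism coord_proj.
Proof. by split=> // f g; rewrite coord_projM. Qed.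

HB.instance Definition _ := GRing.isMonoidMorphism.Build O coord_ring coord_proj
  coord_proj_is_monoid_morphism.

End CoordRing.

Definition submod (R : pzRingType) (V : lmodType R) (S : submodClosed V) :=
  {x : V | x \in S}.

Section Submod.
Variables (R : pzRingType) (V : lmodType R) (S : submodClosed V).

HB.instance Definition _ := SubChoice.on (submod S).
HB.instance Definition _ := [SubChoice_isSubLmodule of submod S by <:].

End Submod.

Definition linhom (A : comPzRingType) (U V : lmodType A) := {linear U -> V}.

Section HomModule.
Variables (A : comPzRingType) (U V : lmodType A).
Implicit Types f g h : linhom U V.

HB.instance Definition _ := gen_eqMixin (linhom U V).
HB.instance Definition _ := gen_choiceMixin (linhom U V).

Lemma homP f g : (forall u, f u = g u) -> f = g.
Proof.
case: f g => [f [fA fZ]] [g [gA gZ]] /= /funext eq_fg; move: eq_fg fA fZ gA gZ.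
move=> -> [fA] [fZ] [gA] [gZ].
by rewrite (Prop_irrelevance fA gA) (Prop_irrelevance fZ gZ).
Qed.

Definition hom_zero : linhom U V := \0%R.
Definition hom_opp f : linhom U V := \- f.
Definition hom_add f g : linhom U V := f \+ g.
Definition hom_scale (a : A) f : linhom U V := a \*: f.

Fact hom_addA : associative hom_add.
Proof. by move=> f g h; apply: homP => u /=; rewrite addrA. Qed.
Fact hom_addC : commutative hom_add.
Proof. by move=> f g; apply: homP => u /=; rewrite addrC. Qed.
Fact hom_add0 : left_id hom_zero hom_add.
Proof. by move=> f; apply: homP => u /=; rewrite add0r. Qed.
Fact hom_addN : left_inverse hom_zero hom_opp hom_add.
Proof. by move=> f; apply: homP => u /=; rewrite addNr. Qed.

HB.instance Definition _ := GRing.isZmodule.Build (linhom U V)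
  hom_addA hom_addC hom_add0 hom_addN.

Fact hom_scaleA a b f : hom_scale a (hom_scale b f) = hom_scale (a * b) f.
Proof. by apply: homP => u /=; rewrite scalerA. Qed.
Fact hom_scale1 : left_id 1 hom_scale.
Proof. by move=> f; apply: homP => u /=; rewrite scale1r. Qed.
Fact hom_scaleDr : right_distributive hom_scale +%R.
Proof. by move=> a f g; apply: homP => u /=; rewrite scalerDr. Qed.
Fact hom_scaleDl f : {morph hom_scale^~ f : a b / a + b}.
Proof. by move=> a b; apply: homP => u /=; rewrite scalerDl. Qed.

HB.instance Definition _ := GRing.Zmodule_isLmodule.Build A (linhom U V)
  hom_scaleA hom_scale1 hom_scaleDr hom_scaleDl.

End HomModule.

Section CurveModule.
Variables (K : comNzRingType) (n : nat) (F : mpseries K n).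
Variable W : germ_map K n 1.

(* The ideal of [W] in [O_X = O / (F)]: classes of the power series that vanish
   identically along the parametrization.  When [W] lies on [F = 0] this is the
   kernel of the pull-back [O_X -> K[[lambda]]]. *)
Definition curve_ideal : {pred (coord_ring F)^o} := fun x =>
  `[< exists2 f, x = coord_proj F f & mps_subst W f = 0 >].

Fact curve_ideal_submod_closed : submod_closed curve_ideal.
Proof.
split=> [|x _ _ /asboolP[f -> f0] /asboolP[g -> g0]]; apply/asboolP.
  by exists 0; rewrite !raddf0.
have [h ->] := coord_proj_surj x; exists (h * f + g).
  by rewrite rmorphD rmorphM.
by rewrite rmorphD rmorphM /= f0 g0 mulr0 addr0.
Qed.

HB.instance Definition _ := GRing.isSubmodClosed.Build (coord_ring F)
  (coord_ring F)^o curve_ideal curve_ideal_submod_closed.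

(* [M = Hom_{O_X}(I_W, O_X)] *)
Definition curve_module : lmodType (coord_ring F) :=
  linhom (submod curve_ideal) (coord_ring F)^o.

End CurveModule.

Definition matrix_factorization (O : comNzRingType) (m : nat) (G : O)
    (Psi Phi : 'M[O]_m) :=
  Phi *m Psi = G%:M /\ Psi *m Phi = G%:M.

(* [0 -> O^m -(Phi)-> O^m -> M -> 0] is an exact sequence of [O]-modules, where
   the [O/(F)]-module [M] is an [O]-module by restriction of scalars. *)
Definition free_resolution (O : comNzRingType) (F : O)
    (M : lmodType (coord_ring F)) (m : nat) (Phi : 'M[O]_m) :=
  exists p : {linear 'cV[O]_m -> M | coord_proj F \; *:%R},
    [/\ injective (fun v : 'cV[O]_m => Phi *m v),
        forall v : 'cV[O]_m, p v = 0 <-> exists u : 'cV[O]_m, v = Phi *m u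
      & forall x : M, exists v : 'cV[O]_m, p v = x].

(* [G] is a defining equation of the hypersurface [F = 0] when [(G) = (F)]. *)
Definition module_factorization (O : comNzRingType) (F : O)
    (M : lmodType (coord_ring F)) (m : nat) (G : O) (Psi Phi : 'M[O]_m) :=
  [/\ principal_ideal G =i principal_ideal F,
      matrix_factorization G Psi Phi & free_resolution M Phi].

Definition poly_G (K : comNzRingType) (O : algType K) (c1 c2 : K) (n : nat)
    (Z1 Z2 : O) : O :=
  c1 *: Z1 ^+ n - c2 ^+ n *: Z2.

Definition poly_S (K : fieldType) (O : algType K) (c1 c2 : K) (n m : nat)
    (Z1 Z2 : O) : O :=
  \sum_(1 <= j < m.+1)
    (c1 ^+ (j - 1) / c2 ^+ (j * n)) *: (Z1 ^+ ((j - 1) * n) * Z2 ^+ (m - j)).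

Definition mx22 (O : Type) (x y z t : O) : 'M[O]_2 :=
  \matrix_(i < 2, j < 2)
    if i == ord0 then (if j == ord0 then x else y)
    else (if j == ord0 then z else t).

Section Surface.
Variable K : fieldType.

Definition X1 : mpseries K 3 := mpvar K (@Ordinal 3 0 isT).
Definition X2 : mpseries K 3 := mpvar K (@Ordinal 3 1 isT).
Definition X3 : mpseries K 3 := mpvar K (@Ordinal 3 2 isT).

Definition surface (r q : nat) (tau : K) : mpseries K 3 :=
  X1 ^+ ((r - 2) * q) + X2 ^+ q + X3 ^+ r + tau *: (X1 * X2 * X3).

Definition curve_coord (r : nat) (omega a b c : K) (i : 'I_3) : mpseries K 1 :=
  let lambda := mpvar K (@Ordinal 1 0 isT) in
  nth 0 [:: (a * omega) *: lambda;
            (b * omega ^+ (r - 2)) *: lambda ^+ (r - 2);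
            c *: lambda] i.

Fact curve_coord0 r (hr : (3 <= r)%N) omega a b c i :
  curve_coord r omega a b c i 0%MM = 0.
Proof.
have low0 j : mpvar K j (0%MM : 'X_{1..1}) = 0.
  rewrite /mpcoef /= (_ : _ == _ = false) //.
  by apply/eqP => /(congr1 mdeg); rewrite mdeg0 mdeg1.
rewrite /curve_coord; case: i => [[|[|[|i]]] lt_i] //=; rewrite mps_coefZ.
- by rewrite low0 mulr0.
- by rewrite mps_low_exp ?mulr0 // mdeg0 subn_gt0.
- by rewrite low0 mulr0.
Qed.

Definition curve (r : nat) (hr : (3 <= r)%N) (omega a b c : K) : germ_map K 3 1 :=
  GermMap (curve_coord0 hr omega a b c).

Definition matrix_A (r q : nat) (omega a b c : K) : 'M[mpseries K 3]_2 :=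
  mx22
    (poly_G c (a * omega) 1 X1 X3)
    (- poly_G b a (r - 2) X1 X2)
    (poly_S b a (r - 2) q X1 X2
      + (c / (a * omega ^+ r)) *: (X1 ^+ 2 * poly_S b a (r - 2) 1 X1 X2))
    (poly_S c (a * omega) 1 r X1 X3
      + (omega ^+ (r - 1))^-1 *: (X1 * X2 * poly_S c (a * omega) 1 1 X1 X3)).

End Surface.

(* Main.v *)
(* Since (a, b, c) is not the origin, a and omega are nonzero, so the ideal I of
   W is generated by x = A11 and y = A12, a regular sequence, and det A = - F by
   the telescoping identity G S = c1^m / c2^(nm) Z1^(nm) - Z2^m.  A homomorphism
   phi : I -> O/(F) is determined by the lifts of phi(x) and phi(y); the Koszul
   relation of (x, y) shows that these are spanned, modulo F, by the two rows of
   A, and as F is not a zero divisor the relations between the rows modulo F are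
   spanned by the rows of adj(A), i.e. by the columns of A up to swapping
   coordinates with a sign.  Membership of a series in I and the regularity of
   (x, y) both come from f(u) - f(v) lying in the ideal of the differences u_i -
   v_i. *)
From HB Require Import structures.
Require Import Defs.
From mathcomp Require Import all_boot all_order all_algebra.
From mathcomp.multinomials Require Import mpoly.
From mathcomp Require Import boolp reals complex.
From mathcomp Require Import ring zify.

Set Implicit Arguments.
Unset Strict Implicit.
Unset Printing Implicit Defensive.

Import GRing.Theory Order.Theory.
Local Open Scope ring_scope.

(** * Formal power series *)

(** Compare the least monomials [mf] and [mg] of the two supports: the coefficient of the product at
    [mf + mg] is the product of the two leading coefficients. *)
Lemma mpseries_integral (K : idomainType) n (f g : mpseries K n) :
  f * g = 0 -> (f == 0) || (g == 0).
Proof.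
have lead (h : mpseries K n) : h != 0 ->
    exists2 m, h m != 0 & forall k, (k < m)%O -> h k = 0.
  move=> nz_h; have /existsNP[m /eqP hm] : ~ forall m, h m = 0.
    by move=> h0; case/eqP: nz_h; apply: mpseriesP.
  elim/(@ltmwf n): m hm => m IH hm.
  have [[k [lt_km hk]]|Nk] := pselect (exists k, (k < m)%O /\ h k != 0).
    exact: IH hk.
  exists m => // k lt_km; apply/eqP/negPn/negP => hk.
  by apply: Nk; exists k.
move=> fg0; apply/negPn/negP; rewrite negb_or.
move=> /andP[/lead[mf nz_f f0] /lead[mg nz_g g0]].
have lt_f : (mdeg mf < (mdeg (mf + mg)%MM).+1)%N by rewrite mdegD ltnS leq_addr.
have lt_g : (mdeg mg < (mdeg (mf + mg)%MM).+1)%N by rewrite mdegD ltnS leq_addl.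
have /eqP := congr1 (fun h : mpseries K n => h (mf + mg)%MM) fg0.
rewrite mps_coef0 mps_coefM (bigD1 (BMultinom lt_f, BMultinom lt_g)) //=.
rewrite big1 => [|[k l] /= /andP[/eqP kl_eq nkl]].
  by rewrite addr0 mulf_eq0 (negPf nz_f) (negPf nz_g).
(* Any other pair of sum [mf + mg] has a member below [mf] or [mg], where the coefficient
   vanishes. *)
have [/f0->|le_fk] := ltP (k : 'X_{1..n}) mf; first by rewrite mul0r.
have [/g0->|le_gl] := ltP (l : 'X_{1..n}) mg; first by rewrite mulr0.
move: le_fk; rewrite le_eqVlt => /predU1P[kE|lt_fk]; last first.
  by have := ltmc_le_add lt_fk le_gl; rewrite -kl_eq ltxx.
have lE : mg = l by apply/eqP; rewrite -(eqm_add2l mf) {2}kE -kl_eq.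
by case/negP: nkl; rewrite xpair_eqE !bmeqP /= -kE -lE !eqxx.
Qed.

(** * Coefficients of a substitution *)

Section SubstitutionLemmas.
Variables (K : comNzRingType).

Lemma eq_mps_mull n (f f' g : mpseries K n) m :
  (forall k, (mdeg k <= mdeg m)%N -> f k = f' k) -> (f * g) m = (f' * g) m.
Proof.
by move=> eq_f; rewrite !mps_coefM; apply: eq_bigr => k _; rewrite eq_f // -ltnS bmdeg.
Qed.

(** The range of the sum in [mps_subst] depends on the coefficient extracted; this brings different
    coefficients to a common range. *)
Lemma sum_bmnm_widen (V : nmodType) n d d' (F : 'X_{1..n} -> V) : (d <= d')%N ->
  (forall k, (d <= mdeg k)%N -> F k = 0) ->
  \sum_(k : 'X_{1..n < d'}) F k = \sum_(k : 'X_{1..n < d}) F k.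
Proof.
move=> le_dd F0.
rewrite (bigID (fun k : 'X_{1..n < d'} => (mdeg k < d)%N)) /= addrC big1 ?add0r; last first.
  by move=> k; rewrite -leqNgt; apply: F0.
(* For [d = 0] the smaller range is empty; otherwise [bm0] serves as the default of [insubd]. *)
case: d => [|d] in le_dd F0 *.
  by rewrite !big_pred0 // => -[].
pose w (k : 'X_{1..n < d.+1}) := BMultinom (leq_trans (bmdeg k) le_dd).
rewrite (reindex_onto w (fun k => insubd bm0 (k : 'X_{1..n}))) /=.
  by apply: eq_bigl => k; rewrite bmdeg -(inj_eq val_inj) /= val_insubd bmdeg eqxx.
by move=> k lt_k; apply/val_inj; rewrite /= val_insubd lt_k.
Qed.

Variables (n p : nat).
Implicit Types (x y : germ_map K n p) (f : mpseries K n).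

Lemma mps_subst_widen x f m d : (mdeg m < d)%N ->
  mps_subst x f m = \sum_(k : 'X_{1..n < d}) f k * (\prod_(i < n) x i ^+ k i) m.
Proof.
move=> lt_md; rewrite (@sum_bmnm_widen _ n (mdeg m).+1 d
  (fun k => f k * (\prod_(i < n) x i ^+ k i) m)) // => k lt_mk.
by rewrite mps_low_monom ?mulr0.
Qed.

Lemma mps_substZ x c f : mps_subst x (c *: f) = c *: mps_subst x f.
Proof.
apply: mpseriesP => m; rewrite mps_coefZ /= mulr_sumr; apply: eq_bigr => k _.
by rewrite mulrA.
Qed.

Lemma mps_subst_var x i : mps_subst x (mpvar K i) = x i.
Proof.
(* One more than the defining bound, so that [U_(i)] is in range even for [m = 0]. *)
apply: mpseriesP => m; rewrite (@mps_subst_widen _ _ _ (mdeg m).+2) //.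
have lt1 : (mdeg (U_(i)%MM : 'X_{1..n}) < (mdeg m).+2)%N by rewrite mdeg1.
rewrite (bigD1 (BMultinom lt1)) //= [X in _ + X]big1 ?addr0 => [|k nk].
  rewrite (_ : \prod_(j < n) _ = x i); last exact: mmap1U.
  by rewrite /mpvar {1}/mpcoef /= eqxx mul1r.
by rewrite /mpvar {1}/mpcoef -(bmeqP k (BMultinom lt1)) (negPf nk) mul0r.
Qed.


End SubstitutionLemmas.

(** * Composition of germs and differences of substitutions *)

Section Composition.
Variables (K : comNzRingType) (n p : nat).
Implicit Types (x y : germ_map K n p) (f : mpseries K n).

Fact germ_comp0 l (z : germ_map K p l) x i : mps_subst z (x i) 0%MM = 0.
Proof.
rewrite (@mps_subst_widen _ _ _ _ _ _ 1) ?mdeg0 // big1 // => k _.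
have /eqP-> : (k : 'X_{1..p}) == 0%MM by rewrite -mdeg_eq0 -leqn0 -ltnS bmdeg.
by rewrite germ_coord0 mul0r.
Qed.

Definition germ_comp l (z : germ_map K p l) x : germ_map K n l :=
  GermMap (germ_comp0 z x).

(** Up to the degree of [m], [mps_subst x f] agrees with a finite combination [g] of monomials in
    the [x i], on which the ring morphism [mps_subst z] acts term by term. *)
Lemma mps_subst_comp l (z : germ_map K p l) x f :
  mps_subst z (mps_subst x f) = mps_subst (germ_comp z x) f.
Proof.
apply: mpseriesP => m; pose d := (mdeg m).+1.
pose g := \sum_(k : 'X_{1..n < d}) f k *: \prod_(i < n) x i ^+ k i.
transitivity (mps_subst z g m).
  apply: eq_bigr => k _; congr (_ * _); rewrite (@mps_subst_widen _ _ _ _ _ _ d) ?bmdeg //.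
  by rewrite mps_coef_sum.
rewrite raddf_sum mps_coef_sum /=; apply: eq_bigr => k _.
rewrite mps_substZ rmorph_prod; congr (_ * mpcoef _ _).
by apply: eq_bigr => i _; rewrite rmorphXn.
Qed.

(** Telescoping, one factor at a time. The degree bound on [H] is what lets the quotients of all
    monomials be summed into a power series. *)
Lemma monom_sub_ideal x y (k : 'X_{1..n}) : exists H : 'I_n -> mpseries K p,
  \prod_(i < n) x i ^+ k i - \prod_(i < n) y i ^+ k i = \sum_(i < n) H i * (x i - y i)
  /\ forall i m, (mdeg m < (mdeg k).-1)%N -> H i m = 0.
Proof.
pose P d (u v : mpseries K p) :=
  [/\ forall m, (mdeg m < d)%N -> u m = 0, forall m, (mdeg m < d)%N -> v m = 0
    & exists H : 'I_n -> mpseries K p, u - v = \sum_(i < n) H i * (x i - y i)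
      /\ forall i m, (mdeg m < d.-1)%N -> H i m = 0].
have P1 : P 0%N 1 1.
  split=> //; exists (fun=> 0); split=> //.
  by rewrite subrr big1 // => i _; rewrite mul0r.
have PM d e u v u' v' : P d u v -> P e u' v' -> P (d + e)%N (u * u') (v * v').
  move=> [u0 v0 [H [HE H0]]] [u'0 v'0 [H' [H'E H'0]]].
  split; try exact: mps_low_mul.
  (* From u u' - v v' = (u - v) u' + v (u' - v'). *)
  exists (fun i => H i * u' + v * H' i); split=> [|i m lt_m].
    rewrite (eq_bigr (fun i => H i * (x i - y i) * u' + v * (H' i * (x i - y i)))).
      by rewrite big_split /= -mulr_suml -mulr_sumr -HE -H'E; ring.
    by move=> i _; ring.
  rewrite mps_coefD (mps_low_mul (H0 i) u'0) ?(mps_low_mul v0 (H'0 i)) ?addr0 //.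
    by move: lt_m; lia.
  by move: lt_m; lia.
have Pvar i : P 1%N (x i) (y i).
  split=> [m|m|]; rewrite ?ltnS ?leqn0 ?mdeg_eq0; try by move/eqP->; rewrite germ_coord0.
  exists (fun j => (j == i)%:R); split=> //.
  rewrite (bigD1 i) //= eqxx mul1r big1 ?addr0 // => j /negPf->.
  by rewrite mul0r.
suff: P (mdeg k) (\prod_(i < n) x i ^+ k i) (\prod_(i < n) y i ^+ k i) by case.
rewrite mdegE; refine (big_rec3 P _ _) => // i d u v _ IH; apply: (PM) => //.
by elim: (k i) => // e IHe; rewrite !exprS -add1n; apply: PM.
Qed.

(* The quotients [h i] are assembled degree by degree from those of the
   monomials, which start in degree [mdeg k - 1]. *)
Lemma mps_subst_sub x y f : exists h : 'I_n -> mpseries K p,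
  mps_subst x f - mps_subst y f = \sum_(i < n) h i * (x i - y i).
Proof.
have [H HP] := choice (monom_sub_ideal x y).
(* Exponents of degree up to [mdeg m + 1] contribute, since a quotient may start one degree below
   its monomial. *)
exists (fun i => MPSeries (fun m =>
  \sum_(k : 'X_{1..n < (mdeg m).+2}) f k * H k i m)).
apply: mpseriesP => m; rewrite mps_coefB mps_coef_sum.
rewrite !(@mps_subst_widen _ _ _ _ _ _ (mdeg m).+2) // -sumrB.
transitivity (\sum_(i < n) \sum_(k : 'X_{1..n < (mdeg m).+2})
                 f k * (H k i * (x i - y i)) m).
  rewrite exchange_big /=; apply: eq_bigr => k _.
  by rewrite -mulrBr -mulr_sumr -mps_coef_sum -mps_coefB; have [-> _] := HP k.
apply: eq_bigr => i _.
transitivity (((\sum_(k : 'X_{1..n < (mdeg m).+2}) f k *: H k i) * (x i - y i)) m).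
  by rewrite mulr_suml mps_coef_sum; apply: eq_bigr => k _; rewrite -scalerAl.
apply: eq_mps_mull => l le_lm; rewrite mps_coef_sum.
rewrite (@sum_bmnm_widen _ n (mdeg l).+2 (mdeg m).+2 (fun k => (f k *: H k i) l)) //.
move=> k lt_lk; have [_ Hk0] := HP k.
by rewrite mps_coefZ Hk0 ?mulr0 // -ltnS prednK // (leq_trans _ lt_lk).
Qed.

End Composition.

(** * The identity substitution *)

Section Identity.
Variables (K : comNzRingType) (n : nat).

Fact mpvar0 (i : 'I_n) : mpvar K i 0%MM = 0.
Proof.
by rewrite /mpcoef /= eq_sym (_ : _ == _ = false) // -mdeg_eq0 mdeg1.
Qed.

Definition germ_id : germ_map K n n := GermMap mpvar0.

Definition mps_monom (k : 'X_{1..n}) : mpseries K n := MPSeries (fun m => (m == k)%:R).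

Lemma mps_monomD k l : mps_monom (k + l)%MM = mps_monom k * mps_monom l.
Proof.
apply: mpseriesP => m; rewrite mps_coefM /mps_monom /mpcoef /=.
have [->|nm] := eqVneq m (k + l)%MM; last first.
  rewrite big1 // => -[k' l'] /= /eqP mE; rewrite -natrM mulnb.
  case: andP => // -[/eqP k'E /eqP l'E]; case/eqP: nm.
  by rewrite mE k'E l'E.
have lt_k : (mdeg k < (mdeg (k + l)%MM).+1)%N by rewrite mdegD ltnS leq_addr.
have lt_l : (mdeg l < (mdeg (k + l)%MM).+1)%N by rewrite mdegD ltnS leq_addl.
rewrite (bigD1 (BMultinom lt_k, BMultinom lt_l)) //= !eqxx mulr1.
rewrite big1 ?addr0 // => -[k' l'] /= /andP[_ nkl]; rewrite -natrM mulnb.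
by rewrite (negPf (nkl : ~~ ((k' == k :> 'X_{1..n}) && (l' == l :> 'X_{1..n})))).
Qed.

Lemma mps_monomE (k : 'X_{1..n}) : \prod_(i < n) mpvar K i ^+ k i = mps_monom k.
Proof.
have monom0 : mps_monom 0%MM = 1 by [].
rewrite [in RHS](multinomUE_id k) (big_morph _ mps_monomD monom0).
apply: eq_bigr => i _; elim: (k i) => [|e IHe]; first by rewrite mulm0n.
by rewrite exprS IHe mulmS mps_monomD.
Qed.

(** Taking this germ for [x] in [mps_subst_sub] writes f - f(y) as a combination of the X_i -
    y_i. *)
Lemma mps_subst_id f : mps_subst germ_id f = f.
Proof.
apply: mpseriesP => m; rewrite {1}/mpcoef /=.
rewrite (bigD1 (BMultinom (ltnSn (mdeg m)))) //= mps_monomE /mps_monom.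
rewrite {2}/mpcoef /= eqxx mulr1 big1 ?addr0 // => k /negPf nk.
rewrite mps_monomE {2}/mpcoef /= eq_sym.
by rewrite -[_ == m]/(k == BMultinom (ltnSn (mdeg m))) nk mulr0.
Qed.

End Identity.

(** * Presentation of Hom(I, O/(F)) for an ideal I generated by two elements *)

Lemma mx22_mulcol (O : comNzRingType) (x y z t : O) (v w : 'cV[O]_2) :
  v = mx22 x y z t *m w <->
  v ord0 ord0 = x * w ord0 ord0 + y * w ord_max ord0 /\
  v ord_max ord0 = z * w ord0 ord0 + t * w ord_max ord0.
Proof.
have sum2 (f : 'I_2 -> O) : \sum_(j < 2) f j = f ord0 + f ord_max.
  by rewrite big_ord_recl big_ord1; congr (_ + f _); apply: val_inj.
split=> [->|[v0 v1]]; first by rewrite !mxE !sum2 !mxE.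
apply/matrixP => i j; rewrite (ord1 j) !mxE sum2 !mxE /=.
by case: i => [[|[|i]] lt_i] //=; [rewrite -v0|rewrite -v1]; congr (v _ _); apply: val_inj.
Qed.

Lemma det_mx22E (O : comNzRingType) (x y z t : O) : \det (mx22 x y z t) = x * t - y * z.
Proof.
rewrite (expand_det_row _ ord0) !big_ord_recl big_ord0 /cofactor !det_mx11 !mxE /=.
by ring.
Qed.

Section HomIdeal.
Variables (O : comNzRingType) (F x y z t : O) (S : submodClosed (coord_ring F)^o).
Hypothesis regF : forall h, h * F = 0 -> h = 0.
Hypothesis detF : x * t - y * z = - F.
Hypothesis memS :
  forall u, u \in S <-> exists f : O * O, u = coord_proj F (f.1 * x + f.2 * y).
Hypothesis koszul :
  forall f g, f * x + g * y = 0 -> exists k, f = - (k * y) /\ g = k * x.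

Local Notation pr := (coord_proj F).

Lemma coord_proj_mulF h : pr (h * F) = 0.
Proof. by rewrite -(raddf0 pr); apply/coord_projE/principal_idealP; exists h; rewrite subr0. Qed.

Lemma coord_proj_eq0 f : pr f = 0 -> exists h, f = h * F.
Proof.
rewrite -(raddf0 pr) => /coord_projE/principal_idealP[h].
by rewrite subr0 => ->; exists h.
Qed.

(* The minor relation x t - y z = - F makes x |-> z, y |-> t respect every
   relation between x and y modulo F. *)
Lemma second_row_well_defined f g :
  pr (f * x + g * y) = 0 -> pr (f * z + g * t) = 0.
Proof.
move=> /coord_proj_eq0[h hE].
have [|k [fE gE]] := @koszul (f + h * t) (g - h * z).
  have -> : (f + h * t) * x + (g - h * z) * y = f * x + g * y + h * (x * t - y * z) by ring.
  by rewrite hE detF; ring.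
have -> : f * z + g * t = - k * F; last exact: coord_proj_mulF.
have -> : f = - (k * y) - h * t by rewrite -fE; ring.
have -> : g = k * x + h * z by rewrite -gE; ring.
by rewrite -[F]opprK -detF; ring.
Qed.

Lemma submod_coef (u : submod S) :
  exists f : O * O, val u = pr (f.1 * x + f.2 * y).
Proof. exact/memS/(valP u). Qed.

(** The homomorphism with x |-> z and y |-> t. The coefficients of [u] are picked by choice;
    [second_row_funE] shows that the pick does not matter. *)
Definition second_row_fun (u : submod S) : (coord_ring F)^o :=
  let f := projT1 (cid (submod_coef u)) in pr (f.1 * z + f.2 * t).

Lemma second_row_funE (u : submod S) f g :
  val u = pr (f * x + g * y) -> second_row_fun u = pr (f * z + g * t).
Proof.
rewrite /second_row_fun; case: cid => -[f' g'] /= -> eq_fg.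
apply/eqP; rewrite -subr_eq0 -raddfB /=.
have -> : f' * z + g' * t - (f * z + g * t) = (f' - f) * z + (g' - g) * t by ring.
apply/eqP/second_row_well_defined.
have -> : (f' - f) * x + (g' - g) * y = f' * x + g' * y - (f * x + g * y) by ring.
by rewrite raddfB /= eq_fg subrr.
Qed.

Fact second_row_fun_linear : linear second_row_fun.
Proof.
move=> a u v; have [h ->] := coord_proj_surj a.
have [[[f g] uE] [[f' g'] vE]] := (submod_coef u, submod_coef v).
rewrite (second_row_funE uE) (second_row_funE vE).
rewrite (@second_row_funE _ (h * f + f') (h * g + g')).
  rewrite -[_ *: _]rmorphM -rmorphD; congr pr; rewrite /=; ring.
rewrite linearP /= uE vE -[_ *: _]rmorphM -rmorphD; congr pr; rewrite /=; ring.
Qed.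

HB.instance Definition _ := GRing.isLinear.Build (coord_ring F) (submod S)
  (coord_ring F)^o *:%R second_row_fun second_row_fun_linear.

Definition second_row : linhom (submod S) (coord_ring F)^o := second_row_fun.
Definition first_row : linhom (submod S) (coord_ring F)^o := \val.

(* The coordinates are swapped, with a sign, because the cokernel of adj(A)^T is
   the one that computes Hom(I, O/(F)), and adj(A)^T = J A J^-1 with J = (0 1;
   -1 0). *)
Definition row_hom (v : 'cV[O]_2) : linhom (submod S) (coord_ring F)^o :=
  pr (v ord_max ord0) *: first_row - pr (v ord0 ord0) *: second_row.

Fact row_hom_linear : linear_for (pr \; *:%R) row_hom.
Proof.
move=> a u v; rewrite /row_hom !mxE !rmorphD !rmorphM /= !scalerDl scalerBr !scalerA.
by rewrite opprD addrACA.
Qed.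

HB.instance Definition _ := GRing.isLinear.Build O 'cV[O]_2
  (linhom (submod S) (coord_ring F)^o) (pr \; *:%R) row_hom row_hom_linear.

Lemma row_homE v (u : submod S) f g : val u = pr (f * x + g * y) ->
  row_hom v u = pr (v ord_max ord0 * (f * x + g * y) - v ord0 ord0 * (f * z + g * t)).
Proof.
move=> uE; rewrite raddfB /= !rmorphM /= -(second_row_funE uE) -uE.
by [].
Qed.

Theorem free_resolution_hom :
  free_resolution (linhom (submod S) (coord_ring F)^o) (mx22 x y z t).
Proof.
have FE : F = y * z - x * t by rewrite -[F]opprK -detF; ring.
have mulFI f g : f * F = g * F -> f = g.
  by move=> fgF; apply/eqP; rewrite -subr_eq0; apply/eqP/regF; rewrite mulrBl fgF subrr.
have Sx : pr x \in S by apply/memS; exists (1, 0); rewrite /= mul1r mul0r addr0.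
have Sy : pr y \in S by apply/memS; exists (0, 1); rewrite /= mul1r mul0r add0r.
pose ux : submod S := Sub (pr x) Sx; pose uy : submod S := Sub (pr y) Sy.
have uxE : val ux = pr (1 * x + 0 * y) by rewrite mul1r mul0r addr0.
have uyE : val uy = pr (0 * x + 1 * y) by rewrite mul1r mul0r add0r.
exists row_hom; split.
- move=> v w /= vw; apply/eqP; rewrite -subr_eq0; apply/eqP.
  (* Multiplying by the adjugate turns A v = A w into F v = F w. *)
  have := congr1 (fun u => \adj (mx22 x y z t) *m u) vw.
  rewrite !mulmxA mul_adj_mx det_mx22E detF !mul_scalar_mx => eqF.
  apply/matrixP => i j; rewrite !mxE; apply: regF.
  have /matrixP/(_ i j) := eqF; rewrite !mxE => eqF'.
  by rewrite mulrBl ![_ * F]mulrC; apply: oppr_inj; rewrite oppr0 opprB -!mulNr eqF' !mulNr; ring.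
- move=> v; split=> [v0|[w /mx22_mulcol[v0E v1E]]].
    have := row_homE v uxE; have := row_homE v uyE; rewrite v0 /=.
    move=> /esym/coord_proj_eq0[k kE] /esym/coord_proj_eq0[l lE].
    (* The values at y and x give v1 y - v0 t = k F and v1 x - v0 z = l F. Eliminating v1, then v0,
       and cancelling F yields v0 = x k - y l and v1 = z k - t l. *)
    exists (\col_i (if i == ord0 then k else - l) : 'cV[O]_2).
    apply/mx22_mulcol; rewrite !mxE /=; split; apply: mulFI.
      transitivity (y * (v ord0 ord0 * z) - x * (v ord0 ord0 * t)).
        by rewrite FE; ring.
      have -> : v ord0 ord0 * z = v ord_max ord0 * x - l * F by rewrite -lE; ring.
      have -> : v ord0 ord0 * t = v ord_max ord0 * y - k * F by rewrite -kE; ring.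
      by ring.
    transitivity (z * (v ord_max ord0 * y) - t * (v ord_max ord0 * x)).
      by rewrite FE; ring.
    have -> : v ord_max ord0 * x = l * F + v ord0 ord0 * z by rewrite -lE; ring.
    have -> : v ord_max ord0 * y = k * F + v ord0 ord0 * t by rewrite -kE; ring.
    by ring.
  apply: homP => u; have [[f g] uE] := submod_coef u.
  rewrite (row_homE _ uE) v0E v1E.
  set e := (X in pr X); have -> : e = (g * w ord0 ord0 - f * w ord_max ord0) * F.
    by rewrite /e FE /=; ring.
  exact: coord_proj_mulF.
move=> phi.
have [[a aE] [b bE]] := (coord_proj_surj (phi ux), coord_proj_surj (phi uy)).
(* Both y phi(x) and x phi(y) are phi(x y), so the lifts [a] and [b] satisfy y a = x b modulo F. *)
have [k kE] : exists k, y * a - x * b = k * F.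
  apply: coord_proj_eq0; rewrite rmorphB !rmorphM /= -aE -bE.
  have -> : pr y * phi ux = phi (pr y *: ux) by rewrite linearZ.
  have -> : pr x * phi uy = phi (pr x *: uy) by rewrite linearZ.
  have -> : pr y *: ux = pr x *: uy by apply: val_inj; rewrite /= [LHS]mulrC.
  exact: subrr.
(* Replacing k F by k (y z - x t) gives an exact relation between x and y, so (a, b) = m (x, y) + k
   (z, t); the swap and sign in [row_hom] then dictate [v]. *)
have [|m [bE' aE']] := @koszul (- (b - k * t)) (a - k * z).
  transitivity (y * a - x * b - k * (y * z - x * t)); first by ring.
  by rewrite kE -FE subrr.
pose v : 'cV[O]_2 := \col_i (if i == ord0 then - k else m).
exists v; apply: homP => u.
have [[f g] uE] := submod_coef u.
have -> : u = pr f *: ux + pr g *: uy.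
  by apply: val_inj; rewrite /= uE rmorphD !rmorphM.
have homE (psi : linhom (submod S) (coord_ring F)^o) :
    psi (pr f *: ux + pr g *: uy) = pr f *: psi ux + pr g *: psi uy.
  by rewrite linearP linearZ.
rewrite (homE (row_hom v)) (homE phi) (row_homE _ uxE) (row_homE _ uyE) aE bE !mxE /=.
congr (_ + _); congr (_ *: _); congr pr.
  have -> : a = m * x + k * z by rewrite -aE' subrK.
  by ring.
have -> : b = m * y + k * t by rewrite -[m * y]opprK -bE' opprK subrK.
by ring.
Qed.
End HomIdeal.

(** * Nonzero series and the product of G and S *)

Lemma mpvar_neq0 (K : comNzRingType) n (i : 'I_n) : mpvar K i != 0.
Proof.
apply/eqP => /(congr1 (fun f : mpseries K n => f U_(i)%MM)) /eqP.
by rewrite mps_coef0 /mpcoef /= eqxx oner_eq0.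
Qed.

Lemma mps_exp_neq0 (K : idomainType) n (f : mpseries K n) e : f != 0 -> f ^+ e != 0.
Proof.
move=> nz_f; elim: e => [|e IHe]; first exact: oner_neq0.
by rewrite exprS; apply/eqP => /mpseries_integral; rewrite (negPf nz_f) (negPf IHe).
Qed.

Lemma in_alg_divff (K : fieldType) (O : algType K) (u : K) :
  u != 0 -> u%:A * u^-1%:A = 1 :> O.
Proof. by move=> nz_u; rewrite -scalerAl mul1r scalerA divff // scale1r. Qed.

(** With w = c1 Z1^n / c2^n, G is c2^n (w - Z2) and S is c2^(-n) times the sum of the w^(j-1)
    Z2^(m-j), so the product telescopes to w^m - Z2^m. *)
Lemma poly_GS (K : fieldType) (O : comAlgType K) (c1 c2 : K) n m (Z1 Z2 : O) :
  c2 != 0 ->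
  poly_G c1 c2 n Z1 Z2 * poly_S c1 c2 n m Z1 Z2
    = (c1 ^+ m / c2 ^+ (m * n)) *: Z1 ^+ (m * n) - Z2 ^+ m.
Proof.
move=> nz_c2; rewrite /poly_G /poly_S; elim: m => [|m IHm].
  by rewrite big_geq // mulr0 mul0n !expr0 divr1 scale1r subrr.
rewrite big_nat_recr //= subnn expr0 mulr1 subn1 /=.
have -> : \sum_(1 <= j < m.+1) (c1 ^+ (j - 1) / c2 ^+ (j * n)) *:
     (Z1 ^+ ((j - 1) * n) * Z2 ^+ (m.+1 - j))
   = Z2 * \sum_(1 <= j < m.+1) (c1 ^+ (j - 1) / c2 ^+ (j * n)) *:
     (Z1 ^+ ((j - 1) * n) * Z2 ^+ (m - j)).
  rewrite mulr_sumr !big_nat; apply: eq_bigr => j /andP[_ lt_jm].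
  by rewrite subSn // exprS -scalerAr mulrCA.
have [u uE] : exists u, u = c2 ^+ n by exists (c2 ^+ n).
rewrite mulrDr mulrCA IHm !mulSn !exprD -uE !exprS.
have scE (k : K) (Z : O) : k *: Z = in_alg O k * Z by rewrite mulr_algl.
have nz_u : u != 0 by rewrite uE expf_neq0.
have [e eE] : exists e, e = c1 ^+ m / c2 ^+ (m * n) by exists (c1 ^+ m / c2 ^+ (m * n)).
have -> : c1 ^+ m / (u * c2 ^+ (m * n)) = u^-1 * e by rewrite eE invfM mulrCA.
have -> : c1 * c1 ^+ m / (u * c2 ^+ (m * n)) = c1 * (u^-1 * e).
  by rewrite eE invfM -!mulrA; congr (_ * _); rewrite mulrCA.
rewrite -eE !scE !rmorphM /=.
have := in_alg_divff O nz_u; move: (u%:A) (u^-1%:A) (c1%:A) (e%:A) => U V C E UV1.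
apply/eqP; rewrite -subr_eq0.
(* The images [U] and [V] of [u] and its inverse are now opaque, so the relation U V = 1 is factored
   out by hand. *)
set lhs := (X in X == 0); have -> : lhs = (1 - U * V) * (E * Z2 * Z1 ^+ (m * n)).
  by rewrite /lhs; ring.
by rewrite UV1 subrr mul0r.
Qed.

Lemma poly_S1 (K : fieldType) (O : comAlgType K) (c1 c2 : K) n (Z1 Z2 : O) :
  poly_S c1 c2 n 1 Z1 Z2 = (c2 ^+ n)^-1 *: 1.
Proof. by rewrite /poly_S big_nat1 subnn mul0n mul1n !expr0 mulr1 div1r. Qed.

Lemma mps_subst_G (K : comNzRingType) n p (x : germ_map K n p) c1 c2 e (Z1 Z2 : mpseries K n) :
  mps_subst x (poly_G c1 c2 e Z1 Z2) = poly_G c1 c2 e (mps_subst x Z1) (mps_subst x Z2).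
Proof. by rewrite /poly_G rmorphB /= !mps_substZ rmorphXn. Qed.

(** * The curve W and the matrix A *)

Section Curve.
Variables (K : fieldType) (r q : nat) (hr : (3 <= r)%N) (hq : (1 <= q)%N).
Variables (tau omega a b c : K).
Hypotheses (htau : tau != 0) (homega : omega ^+ (r - 1) = tau^-1).
Hypothesis habc : (a, b, c) != (0, 0, 0).
Hypothesis hab : a ^+ (q * (r - 2)) + b ^+ q = 0.
Hypothesis hc : c * (c ^+ (r - 1) + a * b) = 0.

Local Notation X1 := (X1 K).
Local Notation X2 := (X2 K).
Local Notation X3 := (X3 K).
Local Notation W := (curve hr omega a b c).
Local Notation G13 := (poly_G c (a * omega) 1 X1 X3).
Local Notation G12 := (poly_G b a (r - 2) X1 X2).
Local Notation i1 := (@Ordinal 3 0 isT).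
Local Notation i2 := (@Ordinal 3 1 isT).
Local Notation i3 := (@Ordinal 3 2 isT).

(** If a = 0, then [hab] and [hc] reduce to b^q = 0 and c^r = 0, which makes the point the
    origin. *)
Let a_neq0 : a != 0.
Proof.
apply/eqP => a0; case/negP: habc; move: hab hc; rewrite a0 mul0r addr0.
rewrite expr0n (_ : _ == 0%N = false) ?add0r; last by apply/eqP; nia.
move=> /eqP; rewrite expf_eq0 => /andP[_ /eqP->]; rewrite -exprS => /eqP.
by rewrite expf_eq0 => /andP[_ /eqP->].
Qed.

Let omega_neq0 : omega != 0.
Proof.
apply/eqP => omega0; move/eqP: homega; rewrite omega0 expr0n subn_eq0 leqNgt.
by rewrite (leq_trans _ hr) // eq_sym invr_eq0 (negPf htau).
Qed.

Let b_expq : b ^+ q = - a ^+ (q * (r - 2)).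
Proof. by apply/eqP; rewrite -addr_eq0 addrC hab. Qed.

Lemma mps_subst_surface p (x : germ_map K 3 p) : mps_subst x (surface r q tau) =
  x i1 ^+ ((r - 2) * q) + x i2 ^+ q + x i3 ^+ r + tau *: (x i1 * x i2 * x i3).
Proof. by rewrite !rmorphD /= mps_substZ !rmorphM !rmorphXn /= !mps_subst_var. Qed.

(** The first two terms cancel by [hab]; as tau omega^(r-1) = 1, the other two add up to c (c^(r-1)
    + a b) lambda^r, zero by [hc]. *)
Lemma curve_on_surface : mps_subst W (surface r q tau) = 0.
Proof.
rewrite mps_subst_surface /= /curve_coord /=.
move: (mpvar K _) => l.
rewrite !exprZn -!exprM -!scalerAl -!scalerAr -!scalerAl !scalerA.
have -> : l * l ^+ (r - 2) * l = l ^+ r by rewrite -exprS mulrC -exprS; congr (_ ^+ _); lia.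
have -> : (b * omega ^+ (r - 2)) ^+ q = - (a * omega) ^+ ((r - 2) * q).
  by rewrite !exprMn -!exprM (mulnC _ q) b_expq mulNr.
rewrite scaleNr subrr add0r -scalerDl (_ : _ + _ = 0) ?scale0r //.
have hr1 : r = (r - 1).+1 by lia.
have -> : tau * (a * omega) * c * (b * omega ^+ (r - 2)) = c * (a * b).
  have -> : tau = (omega ^+ (r - 1))^-1 by rewrite homega invrK.
  have -> : (r - 1 = (r - 2).+1)%N by lia.
  by rewrite exprS; field; rewrite expf_neq0 ?omega_neq0.
by rewrite [X in c ^+ X]hr1 exprS -mulrDr.
Qed.

(** By [poly_GS] the long sums give the pure powers in - F and an extra X1^r term. The one-term sums
    give - tau X1 X2 X3, two opposite X1^2 X2 terms and an X1^r term that cancels the extra one. *)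
Lemma det_matrix_A : \det (matrix_A r q omega a b c) = - surface r q tau.
Proof.
have nz_aw : a * omega != 0 by rewrite mulf_neq0.
rewrite det_mx22E mulNr opprK !mulrDr !poly_GS //.
rewrite !poly_S1 /poly_G !expr1.
have -> : b ^+ q / a ^+ (q * (r - 2)) = -1.
  by rewrite b_expq mulNr divff ?expf_neq0.
have tauE : (omega ^+ (r - 1))^-1 = tau by rewrite homega invrK.
have r1 : (r - 1 = (r - 2).+1)%N by lia.
have rE : r = (r - 2).+2 by lia.
have awrE : c / (a * omega ^+ r) = c * (a * omega)^-1 * tau.
  rewrite -tauE r1 [X in omega ^+ X]rE !exprS; field.
  by rewrite !expf_neq0 ?a_neq0 ?omega_neq0.
(* The cancellation of the two X1^r terms, from c^r = - c a b and omega^r = omega / tau. *)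
have crE : c ^+ r / (a * omega) ^+ (r * 1)
    = - (c * (a * omega)^-1 * tau * (a ^+ (r - 2))^-1 * b).
  have -> : c ^+ r = - (c * (a * b)).
    by apply/eqP; rewrite -addr_eq0 [X in c ^+ X]rE -r1 exprS -mulrDr hc.
  rewrite -tauE muln1 r1 [X in (_ * _) ^+ X]rE !exprS exprMn; field.
  by rewrite !expf_neq0 ?a_neq0 ?omega_neq0.
have X1r : X1 ^+ (r * 1) = X1 ^+ 2 * X1 ^+ (r - 2).
  by rewrite muln1 -exprD; congr (_ ^+ _); lia.
rewrite crE awrE tauE X1r /surface (mulnC _ q).
have scE (k : K) (Z : mpseries K 3) : k *: Z = in_alg _ k * Z by rewrite mulr_algl.
have AW1 := in_alg_divff (mpseries K 3) nz_aw.
have P1 := in_alg_divff (mpseries K 3) (expf_neq0 (r - 2) a_neq0).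
rewrite !scE ?scale1r !(rmorphM, rmorphN, rmorph1) /= in AW1 P1 *.
move: (X1 ^+ (r - 2)) (X1 ^+ (q * (r - 2))) => X1k X1qk.
apply/eqP; rewrite -subr_eq0; set lhs := (X in X == 0).
(* The difference is a combination of the two relations between a scalar and its inverse. *)
have -> : lhs =
    (1 - a%:A * omega%:A * 1 * ((a * omega)^-1%:A * 1)) * (tau%:A * (X1 * X2 * X3))
    + (1 - (a ^+ (r - 2))%:A * 1 * ((a ^- (r - 2))%:A * 1))
      * (c%:A * (a * omega)^-1%:A * tau%:A * (X1 ^+ 2 * X2)).
  by rewrite /lhs; ring.
by rewrite AW1 P1 subrr !mul0r addr0.
Qed.

(** * Generators of the ideal of the curve *)

Lemma mps_subst_G13 p (x : germ_map K 3 p) :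
  mps_subst x G13 = poly_G c (a * omega) 1 (x i1) (x i3).
Proof. by rewrite mps_subst_G !mps_subst_var. Qed.

Lemma mps_subst_G12 p (x : germ_map K 3 p) :
  mps_subst x G12 = poly_G b a (r - 2) (x i1) (x i2).
Proof. by rewrite mps_subst_G !mps_subst_var. Qed.

Fact axis_coord0 (i j : 'I_3) :
  (if j == i then mpvar K i else 0 : mpseries K 3) 0%MM = 0.
Proof. by case: eqP => // _; rewrite mpvar0. Qed.

(** Restricting to a suitable coordinate axis leaves a single term, which shows that a series is
    nonzero. *)
Definition axis i : germ_map K 3 3 := GermMap (axis_coord0 i).

Lemma G13_neq0 : G13 != 0.
Proof.
apply/eqP => /(congr1 (mps_subst (axis i3)))/eqP.
rewrite mps_subst_G13 rmorph0 /= /poly_G !expr1 scaler0 sub0r oppr_eq0 scaler_eq0.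
by rewrite mulf_eq0 (negPf a_neq0) (negPf omega_neq0) (negPf (mpvar_neq0 _ _)).
Qed.

Lemma G12_neq0 : G12 != 0.
Proof.
apply/eqP => /(congr1 (mps_subst (axis i2)))/eqP.
rewrite mps_subst_G12 rmorph0 /= /poly_G expr0n subn_eq0 leqNgt hr scaler0 sub0r.
by rewrite oppr_eq0 scaler_eq0 expf_eq0 (negPf a_neq0) andbF (negPf (mpvar_neq0 _ _)).
Qed.

Lemma surface_neq0 : surface r q tau != 0.
Proof.
apply/eqP => /(congr1 (mps_subst (axis i3)))/eqP.
have rq_neq0 : ((r - 2) * q)%N == 0%N = false by apply/eqP; nia.
have q_neq0 : q == 0%N = false by apply/eqP; lia.
rewrite mps_subst_surface rmorph0 /= !mul0r scaler0 addr0 !expr0n rq_neq0 q_neq0 !add0r.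
by rewrite (negPf (mps_exp_neq0 _ (mpvar_neq0 _ _))).
Qed.


Lemma sum_I3 (V : nmodType) (f : 'I_3 -> V) : \sum_(i < 3) f i = f i1 + f i2 + f i3.
Proof.
rewrite !big_ord_recl big_ord0 addr0 addrA.
by congr (f _ + f _ + f _); apply: val_inj.
Qed.

Fact param_coord0 (i : 'I_1) : ((a * omega)^-1 *: X1) 0%MM = 0.
Proof. by rewrite mps_coefZ mpvar0 mulr0. Qed.

(** Solves X1 = a omega lambda for lambda, so that [germ_comp param W] retracts space onto the
    curve, keeping X1. *)
Definition param : germ_map K 1 3 := GermMap param_coord0.

Lemma germ_comp_param_curve i : germ_comp param W i =
  nth 0 [:: X1; (b / a ^+ (r - 2)) *: X1 ^+ (r - 2); (c / (a * omega)) *: X1] i.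
Proof.
have nz_aw : a * omega != 0 by rewrite mulf_neq0.
rewrite /= /curve_coord.
case: i => [[|[|[|i]]] lt_i] //=; rewrite mps_substZ ?rmorphXn /= mps_subst_var /=.
- by rewrite scalerA divff // scale1r.
- rewrite exprZn scalerA exprVn exprMn; congr (_ *: _); field.
  by rewrite !expf_neq0 ?a_neq0 ?omega_neq0.
- by rewrite scalerA.
Qed.

Lemma G13E : X3 - (c / (a * omega)) *: X1 = - (a * omega)^-1 *: G13.
Proof.
have nz_aw : a * omega != 0 by rewrite mulf_neq0.
rewrite /poly_G !expr1 scalerBr !scalerA !mulNr mulVf // !scaleNr scale1r opprK.
by rewrite addrC mulrC.
Qed.

Lemma G12E : X2 - (b / a ^+ (r - 2)) *: X1 ^+ (r - 2) = (a ^+ (r - 2))^-1 *: (- G12).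
Proof.
rewrite /poly_G opprB scalerBr !scalerA mulVf ?expf_neq0 // scale1r.
by rewrite mulrC.
Qed.

(** [f] vanishes after the retraction onto the curve, so it lies in the ideal of the differences
    between the coordinates and their retractions: 0 and, up to scalars, G12 and G13. *)
Lemma vanish_on_curve f : mps_subst W f = 0 ->
  exists g : mpseries K 3 * mpseries K 3, f = g.1 * G13 + g.2 * (- G12).
Proof.
move=> Wf; have [h] := mps_subst_sub (germ_id K 3) (germ_comp param W) f.
rewrite mps_subst_id -mps_subst_comp Wf rmorph0 subr0 sum_I3 => ->.
rewrite !germ_comp_param_curve /= subrr mulr0 add0r.
exists (- (a * omega)^-1 *: h i3, (a ^+ (r - 2))^-1 *: h i2) => /=.
by rewrite -!scalerAl !scalerAr -G13E -G12E addrC.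
Qed.

Lemma G13_on_curve : mps_subst W G13 = 0.
Proof.
rewrite mps_subst_G13 /= /curve_coord /= /poly_G !expr1 !scalerA mulrC subrr.
by [].
Qed.

Lemma G12_on_curve : mps_subst W G12 = 0.
Proof.
rewrite mps_subst_G12 /= /curve_coord /= /poly_G exprZn exprMn !scalerA.
by rewrite mulrCA subrr.
Qed.

Definition slope_coord (i : 'I_3) : mpseries K 3 :=
  if i == i3 then (c / (a * omega)) *: X1 else mpvar K i.

Fact slope_coord0 i : slope_coord i 0%MM = 0.
Proof. by rewrite /slope_coord; case: eqP; rewrite ?mps_coefZ ?mpvar0 ?mulr0. Qed.

Definition slope : germ_map K 3 3 := GermMap slope_coord0.

(* The substitution X3 := (c / (a omega)) X1 kills G13 and fixes G12. *)
Lemma koszul_G13_G12 f g : f * G13 + g * (- G12) = 0 ->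
  exists k, f = - (k * - G12) /\ g = k * G13.
Proof.
have nz_aw : a * omega != 0 by rewrite mulf_neq0.
move=> fg0; have : mps_subst slope (f * G13 + g * (- G12)) = 0 by rewrite fg0 rmorph0.
rewrite rmorphD !rmorphM rmorphN /= mps_subst_G13 mps_subst_G12 /= /slope_coord /=.
have -> : poly_G c (a * omega) 1 X1 ((c / (a * omega)) *: X1) = 0.
  by rewrite /poly_G !expr1 scalerA mulrC divfK // subrr.
rewrite mulr0 add0r => /mpseries_integral.
rewrite oppr_eq0 (negPf G12_neq0) orbF => /eqP sg0.
(* [g] vanishes on the plane G13 = 0 and only X3 is changed by [slope], so G13 divides [g]. *)
have [h] := mps_subst_sub (germ_id K 3) slope g.
rewrite mps_subst_id sg0 subr0 sum_I3 /= /slope_coord /= !subrr !mulr0 !add0r => gE.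
have {}gE : g = (- (a * omega)^-1 *: h i3) * G13.
  by rewrite -scalerAl scalerAr -G13E.
exists (- (a * omega)^-1 *: h i3); split=> //.
apply/eqP; rewrite -subr_eq0; move: fg0; rewrite gE => fg0.
have /mpseries_integral : (f - - (- (a * omega)^-1 *: h i3 * - G12)) * G13 = 0.
  by rewrite -[RHS]fg0; ring.
by rewrite (negPf G13_neq0) orbF.
Qed.

(** Applies [free_resolution_hom] to the curve ideal, with x = G13 and y = - G12. *)
Theorem curve_module_factorization :
  mps_subst W (surface r q tau) = 0 /\
  module_factorization (curve_module (surface r q tau) W) (- surface r q tau)
    (\adj (matrix_A r q omega a b c)) (matrix_A r q omega a b c).
Proof.
split; first exact: curve_on_surface.
split.
- move=> f; apply/principal_idealP/principal_idealP => -[h ->]; exists (- h).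
    by rewrite mulrN mulNr.
  by rewrite mulrNN.
- by split; rewrite ?mul_mx_adj ?mul_adj_mx det_matrix_A.
apply: free_resolution_hom.
- move=> h /mpseries_integral; rewrite (negPf surface_neq0) orbF.
  by move/eqP.
- by rewrite -det_mx22E det_matrix_A.
- move=> u; split=> [/asboolP[f -> /vanish_on_curve[g ->]]|[g ->]]; first by exists g.
  apply/asboolP; exists (g.1 * G13 + g.2 * - G12) => //.
  by rewrite rmorphD !rmorphM rmorphN /= G13_on_curve G12_on_curve oppr0 !mulr0 addr0.
- exact: koszul_G13_G12.
Qed.

End Curve.

Theorem theorem5p1 (R : realType) (r q : nat) (hr : (3 <= r)%N) (hq : (1 <= q)%N)
    (tau : R[i]) (htau : tau != 0)
    (omega : R[i]) (homega : omega ^+ (r - 1) = tau^-1)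
    (a b c : R[i]) (habc : (a, b, c) != (0, 0, 0))
    (hab : a ^+ (q * (r - 2)) + b ^+ q = 0)
    (hc : c * (c ^+ (r - 1) + a * b) = 0) :
  let F := surface r q tau in
  let W := curve hr omega a b c in
  let A := matrix_A r q omega a b c in
  mps_subst W F = 0 /\
  module_factorization (curve_module F W) (- F) (\adj A) A.
Proof. exact: curve_module_factorization. Qed.
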